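(* Let $\mathcal{E}$ be a fiber determined sheaf of $C^\infty_M$-modules on a smooth manifold $M$ and $U\subset M$ open. Suppose $\alpha\colon[0,1]\to\mathcal{E}(U)$ is smooth with a parameterization $\alpha=\sum_{i\in I}c^ie_i$. Then the following expressions do not depend on the choice of parameterization: $$\frac{d\alpha}{dt}:=\sum_{i\in I}\frac{dc^i}{dt}e_i,\qquad \int_0^t\alpha(s)\,ds:=\sum_{i\in I}\left(\int_0^tc^i(s)\,ds\right)e_i.$$ Furthermore, the fundamental theorem of calculus holds: $$\alpha(t)=\alpha(0)+\int_0^t\frac{d\alpha}{dt}(s)\,ds.$$
   Context: $C^\infty_M$ is the sheaf of smooth functions on $M$. For a sheaf of $C^\infty_M$-modules $\mathcal{E}$ and $x\in M$, the fiber is $\mathrm{Fib}(\mathcal{E})_x=\mathcal{E}_x/\mathfrak{m}_x\mathcal{E}_x$, where $\mathcal{E}_x$ is the stalk and $\mathfrak{m}_x$ the maximal ideal of $C^\infty_{M,x}$; $\mathrm{Fib}(e)_x$ is the class of a section $e$. $\mathcal{E}$ is fiber determined if for all open $U\subset M$ and $e\in\mathcal{E}(U)$: $e=0$ if and only if $\mathrm{Fib}(e)_x=0$ for all $x\in U$. For a manifold $N$ (possibly with boundary), a function $\alpha\colon N\to\mathcal{E}(U)$ is smooth if there exist a locally finite collection of smooth functions $\{c^i\colon N\to C^\infty_M(U)\}_{i\in I}$ (smooth meaning smooth as functions on $N\times U$) and elements $\{e_i\}_{i\in I}\subset\mathcal{E}(U)$ such that $\alpha(x)=\sum_{i\in I}c^i(x)e_i$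 for all $x\in N$. Such a choice of $\{c^i\}$ and $\{e_i\}$ is called a parameterization of $\alpha$. *)

(* Defs.v *)
From HB Require Import structures.
From mathcomp Require Import all_boot all_order all_algebra.
From mathcomp Require Import all_classical all_reals all_analysis.

Set Implicit Arguments.
Unset Strict Implicit.
Unset Printing Implicit Defensive.

Import Order.TTheory GRing.Theory Num.Theory.
Import numFieldNormedType.Exports.

Local Open Scope classical_set_scope.
Local Open Scope ring_scope.
Local Open Scope quotient_scope.

(** * Smooth maps between normed spaces *)

(* [D] is meant to be open and [V] finite dimensional: in that case, existence
   and continuity on [D] of all iterated directional derivatives up to order
   [k] is the usual class C^k. *)
Fixpoint Ck (R : realType) (V W : normedModType R) (k : nat) (D : set V)
    (f : V -> W) : Prop :=
  (forall x, D x -> {for x, continuous f}) /\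
  if k is k'.+1 then
    forall v : V, (forall x, D x -> derivable f x v) /\ Ck k' D ('D_v f)
  else True.

Definition smooth_on (R : realType) (V W : normedModType R) (D : set V)
    (f : V -> W) : Prop :=
  forall k, Ck k D f.

Section CkTheory.
Variables (R : realType) (V : normedModType R).
Implicit Types (D : set V) (f g : V -> R).

Lemma CkW k D f : Ck k.+1 D f -> Ck k D f.
Proof.
elim: k f => [|k IH] f [cf df]; first by split.
by split=> // v; have [dvf /IH] := df v.
Qed.

Lemma Ck_eq k D f g : open D -> (forall x, D x -> f x = g x) ->
  Ck k D f -> Ck k D g.
Proof.
move=> oD; elim: k f g => [|k IH] f g fg [cf df].
all: have e x : D x -> \near x, f x = g x.
1,3: by move=> Dx; apply: (filterS fg); exact: open_nbhs_nbhs.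
all: have cg x : D x -> {for x, continuous g}.
1,3: move=> Dx; have := cf x Dx; rewrite /prop_for /continuous_at (fg x Dx).
1,2: by apply: cvg_trans; apply: near_eq_cvg; exact: e.
  by split.
split=> // v; have [dvf Cf] := df v; split.
  by move=> x Dx; exact: near_eq_derivable (e x Dx) (dvf x Dx).
by apply: IH Cf => x Dx; exact/near_eq_derive/e.
Qed.

Lemma Ck_cst k D (a : R) : Ck k D (cst a : V -> R).
Proof.
elim: k a => [|k IH] a; split=> //; try by move=> x _; exact: cvg_cst.
move=> v; split=> [x _|]; first exact: derivable_cst.
suff -> : 'D_v (cst a) = cst 0 :> (V -> R) by [].
by apply/funext => x; rewrite derive_cst.
Qed.

Lemma CkD k D f g : open D -> Ck k D f -> Ck k D g -> Ck k D (f \+ g).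
Proof.
move=> oD; elim: k f g => [|k IH] f g [cf df] [cg dg]; split=> //;
  try by move=> x Dx; apply: cvgD; [exact: cf|exact: cg].
move=> v; have [dvf Cf] := df v; have [dvg Cg] := dg v; split.
  by move=> x Dx; apply: derivableD; [exact: dvf|exact: dvg].
apply: (Ck_eq oD _ (IH _ _ Cf Cg)) => x Dx /=.
by rewrite -deriveD //; [exact: dvf|exact: dvg].
Qed.

Lemma CkM k D f g : open D -> Ck k D f -> Ck k D g -> Ck k D (f \* g).
Proof.
move=> oD; elim: k f g => [|k IH] f g Cf Cg.
  by split=> // x Dx; apply: cvgM; [exact: Cf.1|exact: Cg.1].
split; first by move=> x Dx; apply: cvgM; [exact: Cf.1|exact: Cg.1].
move=> v; have [dvf Cdf] := Cf.2 v; have [dvg Cdg] := Cg.2 v; split.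
  by move=> x Dx; apply: derivableM; [exact: dvf|exact: dvg].
have C := CkD oD (IH _ _ (CkW Cf) Cdg) (IH _ _ (CkW Cg) Cdf).
apply: (Ck_eq oD _ C) => x Dx /=.
by rewrite deriveM //; [exact: dvf|exact: dvg].
Qed.

End CkTheory.

(** * Open subsets and smooth manifolds *)

Record opens (T : topologicalType) := Opens {
  opens_set :> set T;
  opens_open : open opens_set }.

Definition opensI (T : topologicalType) (U V : opens T) : opens T :=
  Opens (openI (opens_open U) (opens_open V)).

Definition opensIl (T : topologicalType) (U V : opens T) : opensI U V `<=` U :=
  @subIsetl T U V.
Definition opensIr (T : topologicalType) (U V : opens T) : opensI U V `<=` V :=
  @subIsetr T U V.

(* [chart_map] and [chart_inv] are total functions, of which only the values
   on [chart_dom] and [chart_cod] matter. *)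
Record chart (R : realType) (n : nat) (M : topologicalType) := Chart {
  chart_dom : set M;
  chart_cod : set 'rV[R]_n;
  chart_map : M -> 'rV[R]_n;
  chart_inv : 'rV[R]_n -> M;
  chart_dom_open : open chart_dom;
  chart_cod_open : open chart_cod;
  chart_map_cod : forall x, chart_dom x -> chart_cod (chart_map x);
  chart_inv_dom : forall y, chart_cod y -> chart_dom (chart_inv y);
  chart_mapK : forall x, chart_dom x -> chart_inv (chart_map x) = x;
  chart_invK : forall y, chart_cod y -> chart_map (chart_inv y) = y;
  chart_map_continuous : forall x, chart_dom x -> {for x, continuous chart_map};
  chart_inv_continuous : forall y, chart_cod y -> {for y, continuous chart_inv}
}.

(* Smooth manifolds of dimension [n] without boundary; the atlas need not be
   maximal. *)
Record manifold (R : realType) (n : nat) := Manifold {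
  mfd_space :> topologicalType;
  mfd_hausdorff : hausdorff_space mfd_space;
  mfd_second_countable : @second_countable mfd_space;
  mfd_atlas : set (chart R n mfd_space);
  mfd_cover : forall x : mfd_space, exists2 a, mfd_atlas a & chart_dom a x;
  mfd_compatible : forall a b, mfd_atlas a -> mfd_atlas b ->
    smooth_on (chart_cod a `&` chart_inv a @^-1` chart_dom b)
      (chart_map b \o chart_inv a)
}.

(** * The sheaf of smooth functions *)

(* Extension by 0. *)
Definition ext0 (R : realType) (T : Type) (U : set T) (f : U -> R) (x : T) : R :=
  oapp f 0 (insub x).

(* Restriction to a smaller set. *)
Definition restr (R : realType) (T : Type) (U V : set T) (VU : V `<=` U)
    (f : U -> R) : V -> R :=
  fun x => f (exist _ (val x) (mem_set (VU _ (set_mem (valP x))))).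

Section Smooth.
Variables (R : realType) (n : nat) (M : manifold R n).

(* The image in R^n, under the chart [a], of the part of [U] it covers. *)
Definition chart_img (a : chart R n M) (U : set M) : set 'rV[R]_n :=
  chart_cod a `&` chart_inv a @^-1` U.

Definition smooth_fun (U : set M) (f : U -> R) : Prop :=
  forall a, @mfd_atlas R n M a ->
    smooth_on (chart_img a U) (ext0 f \o chart_inv a).

(* Smoothness of [(t, p) |-> c t p] on the manifold with boundary [0,1] x U:
   in charts, the function extends, locally around each point, to a smooth
   function on an open subset of R x R^n.  The values [c t] for [t] outside of
   [0,1] are irrelevant. *)
Definition smooth_fun01 (U : set M) (c : R -> U -> R) : Prop :=
  forall a, @mfd_atlas R n M a ->
  forall (t : R) (y : 'rV[R]_n), t \in `[0, 1] -> chart_img a U y ->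
  exists W : set (R * 'rV[R]_n), exists g : R * 'rV[R]_n -> R,
    [/\ open W, W (t, y), smooth_on W g &
        forall s z, W (s, z) -> s \in `[0, 1] -> chart_img a U z ->
          g (s, z) = ext0 (c s) (chart_inv a z)].

Lemma chart_img_open (a : chart R n M) (U : opens M) : open (chart_img a U).
Proof.
rewrite openE => y [Ay Uy]; apply: filterI.
  by apply: open_nbhs_nbhs; split; [exact: chart_cod_open|].
apply: chart_inv_continuous => //.
by apply: open_nbhs_nbhs; split; [exact: opens_open|].
Qed.

Lemma ext0E (T : Type) (U : set T) (f : U -> R) x (Ux : U x) :
  ext0 f x = f (exist _ x (mem_set Ux)).
Proof.
by rewrite /ext0 (insubT (fun x => x \in U) (mem_set Ux)).
Qed.

Lemma ext0_restr (T : Type) (U V : set T) (VU : V `<=` U) (f : U -> R) x :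
  V x -> ext0 (restr VU f) x = ext0 f x.
Proof.
move=> Vx; rewrite (ext0E _ Vx) (ext0E _ (VU _ Vx)) /restr /=.
by congr f; exact: val_inj.
Qed.

Definition smooth_pred (U : opens M) : {pred U -> R} :=
  fun f => `[< smooth_fun f >].

Lemma smooth_subring (U : opens M) : subring_closed (@smooth_pred U).
Proof.
split.
- apply/asboolP => a _ k.
  apply: (Ck_eq (@chart_img_open a U) _ (Ck_cst k _ 1)) => y [_ Uy] /=.
  by rewrite (ext0E (x := chart_inv a y) _ Uy).
- move=> f g /asboolP sf /asboolP sg; apply/asboolP => a ha k.
  have oD := @chart_img_open a U.
  have C := CkD oD (sf _ ha k) (CkM oD (Ck_cst k _ (-1)) (sg _ ha k)).
  apply: (Ck_eq oD _ C) => y [_ Uy] /=.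
  by rewrite !(ext0E (x := chart_inv a y) _ Uy) mulN1r.
- move=> f g /asboolP sf /asboolP sg; apply/asboolP => a ha k.
  have oD := @chart_img_open a U.
  apply: (Ck_eq oD _ (CkM oD (sf _ ha k) (sg _ ha k))) => y [_ Uy] /=.
  by rewrite !(ext0E (x := chart_inv a y) _ Uy).
Qed.

(* The ring of smooth functions on [U]. *)
Record Cinf (U : opens M) := MkCinf {
  Cinf_fun :> U -> R;
  Cinf_smooth : Cinf_fun \in @smooth_pred U }.

HB.instance Definition _ (U : opens M) := [isSub for @Cinf_fun U].
HB.instance Definition _ (U : opens M) := [Choice of Cinf U by <:].
HB.instance Definition _ (U : opens M) :=
  GRing.SubChoice_isSubComPzRing.Build (U -> R) (@smooth_pred U) (Cinf U)
    (@smooth_subring U).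

Lemma restr_smooth (U V : opens M) (VU : V `<=` U) (f : Cinf U) :
  restr VU f \in @smooth_pred V.
Proof.
apply/asboolP => a ha k; have /asboolP sf := Cinf_smooth f.
have oV := @chart_img_open a V.
apply: (@Ck_eq _ _ _ _ (ext0 f \o chart_inv a)) => //.
  by move=> y [_ Vy] /=; rewrite ext0_restr.
have : chart_img a V `<=` chart_img a U by move=> y [? /VU].
move: (sf _ ha k); move: (chart_img a U) (chart_img a V) => A B.
elim: k (ext0 f \o _) => [|k IH] h [ch dh] BA; split=> //;
  try by move=> x /BA; exact: ch.
by move=> v; have [dv Cv] := dh v; split; [move=> x /BA; exact: dv|exact: IH].
Qed.

Definition Cinf_res (U V : opens M) (VU : V `<=` U) (f : Cinf U) : Cinf V :=
  MkCinf (restr_smooth VU f).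

Lemma Cinf_res_is_zmod_morphism (U V : opens M) (VU : V `<=` U) :
  zmod_morphism (Cinf_res VU).
Proof. by move=> f g; apply: val_inj; apply/funext. Qed.

HB.instance Definition _ (U V : opens M) (VU : V `<=` U) :=
  GRing.isZmodMorphism.Build (Cinf U) (Cinf V) (Cinf_res VU)
    (Cinf_res_is_zmod_morphism VU).

Lemma Cinf_res_id (U : opens M) (UU : U `<=` U) (f : Cinf U) :
  Cinf_res UU f = f.
Proof.
apply: val_inj; apply/funext => x /=; rewrite /restr.
by congr Cinf_fun; exact: val_inj.
Qed.

Lemma Cinf_res_comp (U V W : opens M) (VU : V `<=` U) (WV : W `<=` V)
  (WU : W `<=` U) (f : Cinf U) : Cinf_res WV (Cinf_res VU f) = Cinf_res WU f.
Proof.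
apply: val_inj; apply/funext => x /=; rewrite /restr /=.
by congr Cinf_fun; exact: val_inj.
Qed.

End Smooth.

(** * Presheaves of abelian groups and their stalks *)

Record presheaf (T : topologicalType) := Presheaf {
  psh_sec :> opens T -> zmodType;
  psh_res : forall U V : opens T, V `<=` U -> {additive psh_sec U -> psh_sec V};
  psh_res_id : forall (U : opens T) (UU : U `<=` U) s, psh_res UU s = s;
  psh_res_comp : forall (U V W : opens T) (VU : V `<=` U) (WV : W `<=` V)
    (WU : W `<=` U) s, psh_res WV (psh_res VU s) = psh_res WU s
}.

Section Stalk.
Variables (T : topologicalType) (P : presheaf T) (x : T).

Record local_section := LSec {
  ls_dom : opens T;
  ls_mem : opens_set ls_dom x;
  ls_val : P ls_dom }.

HB.instance Definition _ := gen_eqMixin local_section.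
HB.instance Definition _ := gen_choiceMixin local_section.

Definition germ_eq (a b : local_section) : bool :=
  `[< exists (W : opens T) (Wa : W `<=` ls_dom a) (Wb : W `<=` ls_dom b),
        opens_set W x /\ psh_res P Wa (ls_val a) = psh_res P Wb (ls_val b) >].

Lemma germ_eq_refl : reflexive germ_eq.
Proof.
move=> a; apply/asboolP; exists (ls_dom a), (@subset_refl _ _), (@subset_refl _ _).
by split; first exact: ls_mem.
Qed.

Lemma germ_eq_sym : symmetric germ_eq.
Proof.
move=> a b; apply/asboolP/asboolP => -[W [Wa [Wb [Wx e]]]];
  by exists W, Wb, Wa.
Qed.

Lemma germ_eq_trans : transitive germ_eq.
Proof.
move=> b a c /asboolP[W [Wa [Wb [Wx e]]]] /asboolP[W' [Wb' [Wc [Wx' e']]]].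
apply/asboolP; exists (opensI W W').
exists (subset_trans (@opensIl _ W W') Wa), (subset_trans (@opensIr _ W W') Wc).
split=> //.
rewrite -(psh_res_comp Wa (@opensIl _ W W')) e.
rewrite -(psh_res_comp Wc (@opensIr _ W W')) -e'.
rewrite (psh_res_comp _ _ (subset_trans (@opensIl _ W W') Wb)).
by rewrite (psh_res_comp _ _ (subset_trans (@opensIl _ W W') Wb)).
Qed.

Canonical germ_eq_equiv := EquivRel germ_eq germ_eq_refl germ_eq_sym germ_eq_trans.
Canonical germ_eq_enc := defaultEncModRel germ_eq.

Definition stalk := {eq_quot germ_eq}.
HB.instance Definition _ := EqQuotient.on stalk.
HB.instance Definition _ := Choice.on stalk.

Definition germ (U : opens T) (Ux : opens_set U x) (s : P U) : stalk :=
  \pi_stalk (LSec Ux s).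

Lemma germP (U V : opens T) (Ux : opens_set U x) (Vx : opens_set V x) (s : P U) (t : P V) :
  germ Ux s = germ Vx t <->
  exists (W : opens T) (WU : W `<=` U) (WV : W `<=` V),
    opens_set W x /\ psh_res P WU s = psh_res P WV t.
Proof. by split => [/eqmodP/asboolP//|h]; apply/eqmodP/asboolP. Qed.

Lemma germ_res (U V : opens T) (Ux : opens_set U x) (Vx : opens_set V x) (VU : V `<=` U) (s : P U) :
  germ Vx (psh_res P VU s) = germ Ux s.
Proof.
apply/germP; exists V, (@subset_refl _ _), VU; split=> //.
exact: psh_res_comp.
Qed.

Lemma germ_surj (u : stalk) :
  exists (U : opens T) (Ux : opens_set U x) (s : P U), u = germ Ux s.
Proof.
exists (ls_dom (repr u)), (ls_mem (repr u)), (ls_val (repr u)).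
by rewrite /germ; case: (repr u) (reprK u) => /= U Ux s <-.
Qed.

Lemma germ_surj2 (u v : stalk) :
  exists (U : opens T) (Ux : opens_set U x) (s t : P U), u = germ Ux s /\ v = germ Ux t.
Proof.
have [U [Ux [s ->]]] := germ_surj u; have [V [Vx [t ->]]] := germ_surj v.
have Wx : opens_set (opensI U V) x by [].
exists (opensI U V), Wx, (psh_res P (@opensIl _ U V) s).
by exists (psh_res P (@opensIr _ U V) t); rewrite !germ_res.
Qed.

Definition stalk0 : stalk := germ (U := Opens openT) I 0.

Definition stalk_opp (u : stalk) : stalk :=
  let a := repr u in germ (ls_mem a) (- ls_val a).

Definition stalk_add (u v : stalk) : stalk :=
  let a := repr u in let b := repr v in
  germ (U := opensI (ls_dom a) (ls_dom b)) (conj (ls_mem a) (ls_mem b))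
    (psh_res P (@opensIl _ _ _) (ls_val a) + psh_res P (@opensIr _ _ _) (ls_val b)).

Lemma germ0 (U : opens T) (Ux : opens_set U x) : germ Ux (0 : P U) = stalk0.
Proof.
by apply/germP; exists U, (@subset_refl _ _), (@subsetT _ _); rewrite !raddf0.
Qed.

Lemma germN (U : opens T) (Ux : opens_set U x) (s : P U) :
  stalk_opp (germ Ux s) = germ Ux (- s).
Proof.
rewrite /stalk_opp; case: (repr _) (reprK (germ Ux s)) => /= V Vx t.
move=> /germP[W [WV [WU [Wx e]]]]; apply/germP; exists W, WV, WU.
by rewrite !raddfN e.
Qed.

Lemma germD (U : opens T) (Ux : opens_set U x) (s t : P U) :
  stalk_add (germ Ux s) (germ Ux t) = germ Ux (s + t).
Proof.
rewrite /stalk_add.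
case: (repr _) (reprK (germ Ux s)) => /= V Vx s'.
move=> /germP[W [WV [WU [Wx e]]]].
case: (repr _) (reprK (germ Ux t)) => /= V' Vx' t'.
move=> /germP[W' [WV' [WU' [Wx' e']]]]; apply/germP.
have l := @opensIl _ W W'; have r := @opensIr _ W W'.
have h : opensI W W' `<=` opensI V V' by move=> y [/WV ? /WV'].
exists (opensI W W'), h, (subset_trans l WU); split=> //.
rewrite !raddfD /=; congr (_ + _).
  rewrite (psh_res_comp _ _ (subset_trans l WV)) -(psh_res_comp WV l) e.
  exact: psh_res_comp.
rewrite (psh_res_comp _ _ (subset_trans r WV')) -(psh_res_comp WV' r) e'.
exact: psh_res_comp.
Qed.

Lemma stalk_addC : commutative stalk_add.
Proof.
move=> u v; have [U [Ux [s [t [-> ->]]]]] := germ_surj2 u v.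
by rewrite !germD addrC.
Qed.

Lemma stalk_addA : associative stalk_add.
Proof.
move=> u v w; have [U [Ux [s [t [-> ->]]]]] := germ_surj2 u v.
have [V [Vx [r ->]]] := germ_surj w.
have Wx : opens_set (opensI U V) x by [].
rewrite -(germ_res Ux Wx (@opensIl _ U V) s) -(germ_res Ux Wx (@opensIl _ U V) t).
by rewrite -(germ_res Vx Wx (@opensIr _ U V) r) !germD addrA.
Qed.

Lemma stalk_add0 : left_id stalk0 stalk_add.
Proof.
move=> u; have [U [Ux [s ->]]] := germ_surj u.
by rewrite -(germ0 Ux) germD add0r.
Qed.

Lemma stalk_addN : left_inverse stalk0 stalk_opp stalk_add.
Proof.
move=> u; have [U [Ux [s ->]]] := germ_surj u.
by rewrite germN germD addNr germ0.
Qed.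

HB.instance Definition _ :=
  GRing.isZmodule.Build stalk stalk_addA stalk_addC stalk_add0 stalk_addN.

End Stalk.

(** * Sheaves of modules over the sheaf of smooth functions *)

Section SheafOfModules.
Variables (R : realType) (n : nat) (M : manifold R n).

Definition Cinf_presheaf : presheaf M :=
  @Presheaf M (fun U => Cinf U : zmodType)
    (fun U V VU => Cinf_res VU : {additive Cinf U -> Cinf V})
    (@Cinf_res_id R n M) (@Cinf_res_comp R n M).

Record module_sheaf := ModuleSheaf {
  sec :> forall U : opens M, lmodType (Cinf U);
  res : forall U V : opens M, V `<=` U -> {additive sec U -> sec V};
  resZ : forall (U V : opens M) (VU : V `<=` U) (f : Cinf U) (s : sec U),
    res VU (f *: s) = Cinf_res VU f *: res VU s;
  res_id : forall (U : opens M) (UU : U `<=` U) (s : sec U), res UU s = s;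
  res_comp : forall (U V W : opens M) (VU : V `<=` U) (WV : W `<=` V)
    (WU : W `<=` U) (s : sec U), res WV (res VU s) = res WU s;
  sheaf_locality : forall (U : opens M) (J : Type) (V : J -> opens M)
    (VU : forall j, V j `<=` U), U `<=` \bigcup_j V j ->
    forall s t : sec U, (forall j, res (VU j) s = res (VU j) t) -> s = t;
  sheaf_gluing : forall (U : opens M) (J : Type) (V : J -> opens M)
    (VU : forall j, V j `<=` U), U `<=` \bigcup_j V j ->
    forall s : forall j, sec (V j),
    (forall i j, res (@opensIl _ (V i) (V j)) (s i) =
                 res (@opensIr _ (V i) (V j)) (s j)) ->
    exists t : sec U, forall j, res (VU j) t = s j
}.

Definition presheaf_of (E : module_sheaf) : presheaf M :=
  @Presheaf M (fun U => sec E U : zmodType) (fun U V VU => res E VU)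
    (@res_id E) (@res_comp E).

Section Fiber.
Variables (E : module_sheaf) (x : M).

Local Notation Cx := (stalk Cinf_presheaf x).
Local Notation Ex := (stalk (presheaf_of E) x).

(* Value at [x] of a germ of smooth function. *)
Definition germ_eval (f : Cx) : R :=
  (ls_val (repr f) : Cinf _) (exist _ x (mem_set (ls_mem (repr f)))).

(* Action of the stalk of smooth functions on the stalk of [E]. *)
Definition germ_scale (f : Cx) (u : Ex) : Ex :=
  let a := repr f in let b := repr u in
  germ (P := presheaf_of E)
    (U := opensI (ls_dom a) (ls_dom b)) (conj (ls_mem a) (ls_mem b))
    (Cinf_res (@opensIl _ _ _) (ls_val a : Cinf _) *:
     res E (@opensIr _ _ _) (ls_val b)).

Lemma germ_evalE (U : opens M) (Ux : opens_set U x) (f : Cinf U) :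
  germ_eval (germ (P := Cinf_presheaf) Ux f) = f (exist _ x (mem_set Ux)).
Proof.
rewrite /germ_eval.
case: (repr _) (reprK (germ (P := Cinf_presheaf) Ux f)) => /= V Vx g.
move=> /germP[W [WV [WU [Wx]]]] /(congr1 (@Cinf_fun _ _ _ _)).
move=> /(congr1 (fun h => h (exist _ x (mem_set Wx)))) /=; rewrite /restr /= => e.
by apply: etrans (etrans e _); congr Cinf_fun; exact: val_inj.
Qed.

Lemma germ_scaleE (U : opens M) (Ux : opens_set U x) (f : Cinf U) (s : sec E U) :
  germ_scale (germ (P := Cinf_presheaf) Ux f) (germ (P := presheaf_of E) Ux s) =
  germ (P := presheaf_of E) Ux (f *: s).
Proof.
rewrite /germ_scale.
case: (repr _) (reprK (germ (P := Cinf_presheaf) Ux f)) => /= V Vx f'.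
move=> /germP[W [WV [WU [Wx /= e]]]].
case: (repr _) (reprK (germ (P := presheaf_of E) Ux s)) => /= V' Vx' s'.
move=> /germP[W' [WV' [WU' [Wx' /= e']]]]; apply/germP.
have l := @opensIl _ W W'; have r := @opensIr _ W W'.
have h : opensI W W' `<=` opensI V V' by move=> y [/WV ? /WV'].
exists (opensI W W'), h, (subset_trans l WU); split=> //=.
rewrite !resZ; congr (_ *: _).
  rewrite (Cinf_res_comp _ _ (subset_trans l WV)) -(Cinf_res_comp WV l) e.
  exact: Cinf_res_comp.
rewrite (res_comp _ _ (subset_trans r WV')) -(res_comp WV' r) e'.
exact: res_comp.
Qed.

(* The maximal ideal of the stalk of smooth functions: the germs vanishing
   at [x]. *)
Definition max_ideal : set Cx := [set f | germ_eval f = 0].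

(* The submodule m_x E_x: finite sums of products. *)
Definition max_ideal_mul : {pred Ex} := fun u =>
  `[< exists (k : nat) (f : 'I_k -> Cx) (v : 'I_k -> Ex),
        (forall i, max_ideal (f i)) /\ u = \sum_(i < k) germ_scale (f i) (v i) >].

Lemma germ_scaleN (f : Cx) (v : Ex) : germ_scale f (- v) = - germ_scale f v.
Proof.
have [U [Ux [g ->]]] := germ_surj f; have [V [Vx [s ->]]] := germ_surj v.
have Wx : opens_set (opensI U V) x by [].
rewrite -(germ_res Ux Wx (@opensIl _ U V) g).
rewrite -(germ_res Vx Wx (@opensIr _ U V) s).
rewrite -[- germ _ _]/(stalk_opp _) germN germ_scaleE.
rewrite -[- germ_scale _ _]/(stalk_opp _) germ_scaleE germN.
by congr germ; exact: scalerN.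
Qed.

Lemma max_ideal_mul_zmod_closed : zmod_closed max_ideal_mul.
Proof.
split=> [|u v].
  apply/asboolP; exists 0%N, (fun=> 0), (fun=> 0); split=> [[]//|].
  by rewrite big_ord0.
move=> /asboolP[k [f [w [mf ->]]]] /asboolP[l [g [z [mg ->]]]].
apply/asboolP; exists (k + l)%N.
exists (fun i => match fintype.split i with inl a => f a | inr b => g b end).
exists (fun i => match fintype.split i with inl a => w a | inr b => - z b end).
split=> [i|]; first by case: (fintype.split i).
rewrite big_split_ord /= -sumrN; congr (_ + _); apply: eq_bigr => i _.
  by rewrite -[lshift l i]/(unsplit (inl i)) unsplitK.
by rewrite -[rshift k i]/(unsplit (inr i)) unsplitK germ_scaleN.
Qed.

HB.instance Definition _ :=
  GRing.isZmodClosed.Build Ex max_ideal_mul max_ideal_mul_zmod_closed.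

(* The fiber E_x / m_x E_x. *)
Definition fiber : zmodType := Quotient.quot max_ideal_mul.

Definition Fib (U : opens M) (Ux : opens_set U x) (e : sec E U) : fiber :=
  \pi_(Quotient.quot max_ideal_mul) (germ (P := presheaf_of E) Ux e).

End Fiber.

Definition fiber_determined (E : module_sheaf) : Prop :=
  forall (U : opens M) (e : sec E U),
    e = 0 <-> forall (x : M) (Ux : opens_set U x), Fib Ux e = 0.

(** * Locally finite sums, smooth paths of sections *)

Section Paths.
Variables (E : module_sheaf) (U : opens M).

(* [s] is the sum of the [f i *: e i], where the [f i] are smooth functions on
   [U] forming a locally finite family: on each open set where only finitely
   many [f i] are nonzero, [s] restricts to the finite sum.  In
   [\sum_(i \in [set: I])] only the finitely many nonzero terms contribute. *)
Definition locfin_sum (I : choiceType) (f : I -> U -> R) (e : I -> sec E U)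
    (s : sec E U) : Prop :=
  exists F : I -> Cinf U,
  [/\ forall i, F i = f i :> (U -> R),
      forall x, opens_set U x -> exists (V : opens M) (VU : V `<=` U),
        opens_set V x /\ finite_set [set i | Cinf_res VU (F i) != 0] &
      forall (V : opens M) (VU : V `<=` U),
        finite_set [set i | Cinf_res VU (F i) != 0] ->
        res E VU s = \sum_(i \in [set: I]) (Cinf_res VU (F i) *: res E VU (e i))].

(* [c] and [e] form a parameterization of [alpha : [0,1] -> E(U)].  Local
   finiteness of the family [c] is meant on [0,1] x U. *)
Definition parameterization (alpha : R -> sec E U) (I : choiceType)
    (c : I -> R -> U -> R) (e : I -> sec E U) : Prop :=
  [/\ forall i, smooth_fun01 (c i),
      forall (t : R) (p : M), t \in `[0, 1] -> opens_set U p ->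
        exists (A : set R) (B : set M), [/\ nbhs t A, nbhs p B &
          finite_set [set i | exists s (q : U),
            [/\ s \in `[0, 1], A s, B (val q) & c i s q != 0]]] &
      forall t, t \in `[0, 1] -> locfin_sum (fun i => c i t) e (alpha t)].

Definition smooth_path (alpha : R -> sec E U) : Prop :=
  exists (I : choiceType) (c : I -> R -> U -> R) (e : I -> sec E U),
    parameterization alpha c e.

(* One-sided derivative at the end points. *)
Definition ddt (c : R -> U -> R) (t : R) : U -> R := fun p =>
  lim ((c s p - c t p) / (s - t) @[s --> within `[0, 1] t^']).

Definition int0 (c : R -> U -> R) (t : R) : U -> R := fun p =>
  \int[lebesgue_measure]_(s in `[0, t]) (c s p).

(* [beta] is d alpha/dt, computed from any parameterization of [alpha]. *)
Definition is_ddt (alpha beta : R -> sec E U) : Prop :=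
  forall (I : choiceType) (c : I -> R -> U -> R) (e : I -> sec E U),
    parameterization alpha c e ->
    forall t, t \in `[0, 1] -> locfin_sum (fun i => ddt (c i) t) e (beta t).

(* [beta] is t |-> \int_0^t alpha, computed from any parameterization of
   [alpha]. *)
Definition is_int0 (alpha beta : R -> sec E U) : Prop :=
  forall (I : choiceType) (c : I -> R -> U -> R) (e : I -> sec E U),
    parameterization alpha c e ->
    forall t, t \in `[0, 1] -> locfin_sum (fun i => int0 (c i) t) e (beta t).

Lemma locfin_sum_unique (I : choiceType) (f : I -> U -> R) (e : I -> sec E U)
    (s t : sec E U) : locfin_sum f e s -> locfin_sum f e t -> s = t.
Proof.
move=> [F [Ff lF sF]] [G [Gf lG tG]].
have FG : F = G by apply/funext => i; apply: val_inj; rewrite /= Ff Gf.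
pose J := {V : opens M | exists VU : V `<=` U,
  finite_set [set i | Cinf_res VU (F i) != 0]}.
have VU (j : J) : sval j `<=` U by case: (svalP j).
apply: (sheaf_locality (V := fun j : J => sval j) (VU := VU)).
  move=> x Ux; have [V [h [Vx fin]]] := lF x Ux.
  by exists (exist _ V (ex_intro _ h fin)).
move=> [V [h fin]] /=; have -> : VU (exist _ V (ex_intro _ h fin)) = h by [].
by rewrite sF // tG -?FG.
Qed.

End Paths.
End SheafOfModules.

(* Main.v *)
Require Import Defs.
From HB Require Import structures.
From mathcomp Require Import all_boot all_order all_algebra.
From mathcomp Require Import all_classical all_reals all_analysis.
From mathcomp Require Import ring lra finmap.

(** The derivative at [t] and the integral up to [t] are linear functionals on
functions of one real variable, and this is what makes the two sums independent
of the parameterization.  Since [E] is fiber determined, sections are compared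
in the fiber at each point [x].  There a locally finite sum of [f_i e_i] only
depends on the numbers [f_i(x)]: near [x] it is a finite sum, and
[f_i - f_i(x)] vanishes at [x] ([Fib_locfin_sum]).  Two parameterizations of
one path thus give a relation [\sum_k a_k(t) v_k = 0] that holds for all [t] in
[[0, 1]], with finitely many fixed vectors [v_k] in the fiber and scalar
functions [a_k].  A linear functional [T] preserves every such relation, that
is [\sum_k T(a_k) v_k = 0]; this is [linear_relation_functional], a Gaussian
elimination that needs no dimension or topology on the fiber.

One finite set of indices has to serve for all times at once near [x].  It
exists because [[0, 1]] is compact ([parameterization_tube]), and the same fact
makes the families of derivatives and of integrals locally finite, so that
their sums exist by gluing ([locfin_exists]).

The analysis consists in showing that these families are smooth.  In a chart a
coefficient is a family of functions on an open set [D] that extends, locally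
around each point of [[0, 1] x D], to a smooth function ([smooth01]).  This
property is inherited by time slices, by the time derivative and by
directional derivatives along [D], all of which are read off the local
extension.  Integrals up to [t] are of class C^k by induction on [k]:
differentiation under the integral sign replaces the family by one of its
directional derivatives, which is again [smooth01].

The fundamental theorem of calculus is finally the one for real functions,
applied to each coefficient at each point [x] and summed in the fiber. *)

Set Implicit Arguments.
Unset Strict Implicit.
Unset Printing Implicit Defensive.

Import Order.TTheory GRing.Theory Num.Theory.
Import numFieldNormedType.Exports.

Local Open Scope classical_set_scope.
Local Open Scope ring_scope.

(** * Locality and slices of functions of class C^k *)

Section CkLocality.
Variables (R : realType) (V : normedModType R).
Implicit Types (D : set V) (f : V -> R).

Lemma Ck_sub k D D' f : D' `<=` D -> Ck k D f -> Ck k D' f.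
Proof.
move=> D'D; elim: k f => [|k IH] f [cf df]; split=> //; try by move=> x /D'D /cf.
by move=> v; have [dvf Cf] := df v; split; [move=> x /D'D /dvf|exact: IH].
Qed.

Lemma Ck_local k D f :
  (forall x, D x -> exists D', D' x /\ Ck k D' f) -> Ck k D f.
Proof.
elim: k f => [|k IH] f lf.
  by split=> // x /lf[D' [D'x [cf _]]]; exact: cf.
split=> [x /lf[D' [D'x [cf _]]]|v]; first exact: cf.
split=> [x /lf[D' [D'x [_ df]]]|]; first exact: (df v).1.
by apply: IH => x /lf[D' [D'x [_ df]]]; exists D'; split=> //; exact: (df v).2.
Qed.

End CkLocality.

Section Slices.
Variables (R : realType) (V : normedModType R).
Implicit Types (g : R * V -> R) (W : set (R * V)).

Lemma pair_continuous (t : R) : continuous (fun z : V => (t, z)).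
Proof. by move=> z; exact: (cvg_pair (f := fun=> t) (g := id) (cvg_cst _) cvg_id). Qed.

Lemma open_slice W (t : R) : open W -> open [set z | W (t, z)].
Proof. by move=> oW; apply: open_comp => // z _; exact: pair_continuous. Qed.

(** Directional derivatives of a slice are directional derivatives of [g] along
[(0, v)]: already the difference quotients agree, so that existence and value
are transferred together. *)
Lemma slice_quotient g (t : R) (z v : V) :
  (fun h : R => h^-1 *: (((fun y => g (t, y)) \o shift z) (h *: v) - g (t, z))) =
  (fun h : R => h^-1 *: ((g \o shift (t, z)) (h *: (0, v)) - g (t, z))).
Proof.
apply/funext => h /=; congr (_ *: (g _ - _)).
by rewrite -[RHS]/(h *: 0 + t, h *: v + z) scaler0 add0r.
Qed.

Lemma derivable_slice g (t : R) (z v : V) :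
  derivable g (t, z) (0, v) -> derivable (fun y => g (t, y)) z v.
Proof. by rewrite /derivable slice_quotient. Qed.

Lemma derive_slice g (t : R) (z v : V) :
  'D_v (fun y => g (t, y)) z = 'D_(0, v) g (t, z).
Proof. by rewrite /derive slice_quotient. Qed.

Lemma Ck_slice k W g (t : R) :
  Ck k W g -> Ck k [set z | W (t, z)] (fun z => g (t, z)).
Proof.
elim: k g => [|k IH] g [cg dg].
all: have cs z : W (t, z) -> {for z, continuous (fun z => g (t, z))}.
1,3: by move=> Wz; apply: continuous_comp; [exact: pair_continuous|exact: cg].
  by split.
split=> // v; split=> [z Wz|]; first exact/derivable_slice/(dg (0, v)).1.
rewrite (_ : 'D_v _ = fun z => 'D_(0, v) g (t, z)); first exact: IH (dg (0, v)).2.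
by apply/funext => z; exact: derive_slice.
Qed.

Lemma fst_slice_quotient g (t : R) (z : V) :
  (fun h : R => h^-1 *: (((fun s => g (s, z)) \o shift t) (h *: 1) - g (t, z))) =
  (fun h : R => h^-1 *: ((g \o shift (t, z)) (h *: (1, 0)) - g (t, z))).
Proof.
apply/funext => h /=; congr (_ *: (g _ - _)).
by rewrite -[RHS]/(h *: 1 + t, h *: 0 + z) scaler0 add0r.
Qed.

Lemma derivable_fst_slice g (t : R) (z : V) :
  derivable g (t, z) (1, 0) -> derivable (fun s => g (s, z)) t 1.
Proof. by rewrite /derivable fst_slice_quotient. Qed.

Lemma derive_fst_slice g (t : R) (z : V) :
  'D_1 (fun s => g (s, z)) t = 'D_(1, 0) g (t, z).
Proof. by rewrite /derive fst_slice_quotient. Qed.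

End Slices.

(** * Calculus on the unit interval *)

Section Paths01.
Variable R : realType.
Implicit Types (phi psi : R -> R) (t : R).

(** With these two functionals, [ddt c t q] is [deriv01 (c ^~ q) t] and
[int0 c t q] is [integral01 (c ^~ q) t], by definition. *)
Definition deriv01 phi t : R :=
  lim ((phi s - phi t) / (s - t) @[s --> within `[0, 1] t^']).

Definition integral01 phi t : R :=
  \int[lebesgue_measure]_(s in `[0, t]) phi s.

(** At the end points [phi] only has one-sided derivatives, and its values
outside of the interval are arbitrary; the two-sided theory is reached through
a function [psi] that agrees with [phi] on the interval near [t]. *)
Definition derivable_ext_at phi t psi : Prop :=
  (\forall s \near t, s \in `[0, 1] -> phi s = psi s) /\ derivable psi t 1.

(** A point of the interval is never isolated in it, so that limits along this
filter are unique and [deriv01] can be computed. *)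
Lemma within01_proper t : t \in `[0, 1] ->
  ProperFilter (within [set` `[0, 1]] t^').
Proof.
rewrite in_itv /= => /andP[t0 t1].
apply: Build_ProperFilter_ex => P [e /= e0 Pe].
have [t1'|t1'] := ltP t 1.
  have m0 : 0 < Num.min (e / 2) (1 - t) by rewrite lt_min subr_gt0 t1' divr_gt0.
  have me : Num.min (e / 2) (1 - t) <= e / 2 by rewrite ge_min lexx.
  have mt : Num.min (e / 2) (1 - t) <= 1 - t by rewrite ge_min lexx orbT.
  move: (Num.min _ _) m0 me mt => m m0 me mt.
  exists (t + m); apply: (Pe (t + m)) => /=.
  - rewrite opprD addNKr normrN gtr0_norm//; lra.
  - by apply/eqP; lra.
  - rewrite in_itv /=; lra.
have te : t = 1 by lra.
have m0 : 0 < Num.min (e / 2) 1 by rewrite lt_min ltr01 divr_gt0.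
have me : Num.min (e / 2) 1 <= e / 2 by rewrite ge_min lexx.
have mt : Num.min (e / 2) 1 <= 1 :> R by rewrite ge_min lexx orbT.
move: (Num.min _ _) m0 me mt => m m0 me mt.
exists (1 - m); apply: (Pe (1 - m)) => /=.
- rewrite te opprB addrC subrK gtr0_norm//; lra.
- by apply/eqP; lra.
- rewrite in_itv /=; lra.
Qed.

Lemma derivable_ext_cvg phi t psi : t \in `[0, 1] -> derivable_ext_at phi t psi ->
  (phi s - phi t) / (s - t) @[s --> within `[0, 1] t^'] --> 'D_1 psi t.
Proof.
move=> t01 [pp dpsi].
have pt : phi t = psi t by exact: nbhs_singleton pp _.
have sh : (s - t) @[s --> within [set` `[0, 1]] t^'] --> 0^'.
  move=> P [e /= e0 Pe]; exists e => //= s se st _; apply: Pe => /=.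
    by rewrite sub0r normrN distrC.
  by rewrite subr_eq0.
apply: cvg_trans (cvg_comp _ _ sh dpsi).
apply: near_eq_cvg; rewrite near_withinE near_withinE.
near=> s => st s01 /=.
rewrite /GRing.scale /= mulr1 subrK [RHS]mulrC pt; congr (_ * (_ - _)).
by apply/esym; move: s01; near: s.
Unshelve. all: by end_near. Qed.

Lemma deriv01E phi t psi : t \in `[0, 1] -> derivable_ext_at phi t psi ->
  deriv01 phi t = 'D_1 psi t.
Proof.
move=> t01 h; have := within01_proper t01 => pf.
by apply: cvg_lim => //; exact: derivable_ext_cvg.
Qed.

Definition cont01 phi := {within `[0, 1], continuous phi}.

Lemma cont01_integrable phi t : t \in `[0, 1] -> cont01 phi ->
  lebesgue_measure.-integrable `[0, t] (EFin \o phi).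
Proof.
rewrite in_itv /= => /andP[t0 t1] cphi.
apply: continuous_compact_integrable; first exact: segment_compact.
apply: continuous_subspaceW cphi => s /=; rewrite !in_itv /=; lra.
Qed.

Lemma dist_integral01 phi psi t (e : R) : t \in `[0, 1] -> cont01 phi -> cont01 psi ->
  (forall s, s \in `[0, 1] -> `|phi s - psi s| <= e) ->
  `|integral01 phi t - integral01 psi t| <= e.
Proof.
rewrite /integral01; move=> t01 cphi cpsi le_e.
have [t0 t1] : 0 <= t /\ t <= 1 by move: t01; rewrite in_itv /= => /andP.
have iphi := cont01_integrable t01 cphi; have ipsi := cont01_integrable t01 cpsi.
have mI : measurable (`[0, t] : set (measurableTypeR R)) by exact: measurable_itv.
rewrite -(RintegralB mI iphi ipsi).
have idiff : lebesgue_measure.-integrable `[0, t] (EFin \o (fun s => phi s - psi s)).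
  exact: (integrableB mI iphi ipsi).
apply: (le_trans (le_normr_Rintegral mI idiff)).
have e0 : 0 <= e by apply: le_trans (le_e 0 _) => //; rewrite in_itv /= lexx ler01.
apply: (@le_trans _ _ (\int[lebesgue_measure]_(s in `[0, t]) e)).
  apply: (le_Rintegral mI) => //.
  - exact: integrable_norm idiff.
  - apply: continuous_compact_integrable; first exact: segment_compact.
    by move=> x; exact: cvg_cst.
  - move=> s /=; rewrite in_itv /= => /andP[s0 st]; apply: le_e.
    by rewrite in_itv /= s0 (le_trans st).
have mt : fine (lebesgue_measure (`[0, t] : set R)) = t.
  rewrite lebesgue_measure_itv /= lte_fin; case: ltP => [//|t0' /=].
    by rewrite oppr0 addr0.
  by apply/le_anti; rewrite t0 t0'.
rewrite (Rintegral_cst _ mI); rewrite /mkset in mt *; rewrite mt; exact: ler_piMr.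
Qed.

(** In the interior [phi] coincides with its local extension on a full
neighborhood, hence is differentiable there; at the end points continuity from
inside is all that the two-sided theorem requires. *)
Lemma ftc01 phi t : t \in `[0, 1] ->
  (forall s, s \in `[0, 1] -> exists psi, derivable_ext_at phi s psi) ->
  cont01 (deriv01 phi) ->
  integral01 (deriv01 phi) t = phi t - phi 0.
Proof.
move=> t01 ephi cd.
have [t0 t1] : 0 <= t /\ t <= 1 by move: t01; rewrite in_itv /= => /andP.
move: t0; rewrite le_eqVlt => /predU1P[<-|t0].
  by rewrite /integral01 set_itv1 Rintegral_set1 subrr.
have nearI (s : R) : 0 < s -> s < t -> \forall u \near s, u \in `[0, 1].
  move=> s0 st; have : s \in `]0, t[ by rewrite in_itv /= s0.
  move=> /near_in_itvoo; apply: filterS => u; rewrite !in_itv /= => /andP[u0 ut].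
  by rewrite (ltW u0) (le_trans (ltW ut)).
have contphi (s : R) : s \in `[0, 1] -> phi u @[u --> within [set` `[0, 1]] (nbhs s)] --> phi s.
  move=> s01; have [psi [pp dpsi]] := ephi _ s01.
  rewrite (nbhs_singleton pp s01).
  apply: (@cvg_trans _ (psi u @[u --> within [set` `[0, 1]] (nbhs s)])).
    apply: near_eq_cvg; rewrite near_withinE.
    by apply: filterS pp => u pu u01; rewrite pu.
  apply: cvg_within_filter; apply: differentiable_continuous.
  exact/derivable1_diffP.
rewrite /integral01 /Rintegral (continuous_FTC2 (F := phi) t0)//.
- apply: continuous_subspaceW cd => s /=; rewrite !in_itv /=; lra.
- split.
  + move=> s; rewrite in_itv /= => /andP[s0 st].
    have s01 : s \in `[0, 1] by rewrite in_itv /=; lra.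
    have [psi [pp dpsi]] := ephi _ s01.
    apply: (near_eq_derivable _ dpsi).
    by apply: filterS2 pp (nearI s s0 st) => u pu u01; rewrite pu.
  + have h0 : 0 \in `[0, 1 : R] by rewrite in_itv /= lexx ler01.
    apply: cvg_trans (contphi 0 h0); apply: cvg_app => P.
    move=> /= P0'; have P0 : \forall u \near (0 : R), u \in `[0, 1] -> P u by [].
    near=> u.
    have : u \in `[0, 1] -> P u.
      by near: u; rewrite near_withinE; apply: filterS P0 => u Pu _; exact: Pu.
    by apply; rewrite in_itv /=; apply/andP; split; near: u;
      [exact: nbhs_right_ge|apply: nbhs_right_ltW; exact: lt_le_trans t1].
  + apply: cvg_trans (contphi t t01); apply: cvg_app => P.
    move=> /= P0'; have P0 : \forall u \near (t : R), u \in `[0, 1] -> P u by [].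
    near=> u.
    have : u \in `[0, 1] -> P u.
      by near: u; rewrite near_withinE; apply: filterS P0 => u Pu _; exact: Pu.
    by apply; rewrite in_itv /=; apply/andP; split; near: u;
      [exact: nbhs_left_ge|apply: filterS (nbhs_left_le t) => u /le_trans; exact].
- move=> s; rewrite in_itv /= => /andP[s0 st].
  have s01 : s \in `[0, 1] by rewrite in_itv /=; lra.
  have [psi pp] := ephi _ s01.
  rewrite (deriv01E s01 pp) derive1E; apply: near_eq_derive.
  by apply: filterS2 pp.1 (nearI s s0 st) => u /[apply].
Unshelve. all: by end_near. Qed.
End Paths01.

(** * Families of functions smooth up to the ends of the interval *)

Section SmoothFamilies.
Variables (R : realType) (V : normedModType R) (D : set V).
Hypothesis oD : open D.
Implicit Types (h : R -> V -> R) (t : R) (y v : V).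

(** This is the condition that [smooth_fun01] imposes in each chart, stated for
an open subset of any normed space. *)
Definition smooth01 h : Prop := forall t y, t \in `[0, 1] -> D y ->
  exists W : set (R * V), exists g : R * V -> R,
    [/\ open W, W (t, y), smooth_on W g &
        forall s z, W (s, z) -> s \in `[0, 1] -> D z -> g (s, z) = h s z].

Lemma smooth01_derivable_ext h t y : smooth01 h -> t \in `[0, 1] -> D y ->
  exists psi, derivable_ext_at (h ^~ y) t psi.
Proof.
move=> sh t01 Dy; have [W [g [oW Wty sg gh]]] := sh t y t01 Dy.
exists (fun s => g (s, y)); split.
  have : \forall p \near (t, y), W p by apply: open_nbhs_nbhs; split.
  move=> [[A B] /= [At By] AB]; apply: filterS At => s As s01.
  by rewrite gh//; apply: AB; split=> //; exact: nbhs_singleton By.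
by apply: derivable_fst_slice; exact: ((sg 1%N).2 (1, 0)).1.
Qed.

(** If [g] extends [h] near a point, then the partial derivative of [g] along
[(1, 0)] extends the time derivative of [h], on the same open set. *)
Lemma smooth01_deriv01 h : smooth01 h -> smooth01 (fun t y => deriv01 (h ^~ y) t).
Proof.
move=> sh t y t01 Dy; have [W [g [oW Wty sg gh]]] := sh t y t01 Dy.
exists W, ('D_(1, 0) g); split=> //; first by move=> k; exact: ((sg k.+1).2 (1, 0)).2.
move=> s z Wsz s01 Dz; rewrite -derive_fst_slice; apply/esym/deriv01E => //; split.
  have : \forall p \near (s, z), W p by apply: open_nbhs_nbhs; split.
  move=> [[A B] /= [As Bz] AB]; apply: filterS As => u Au u01.
  by rewrite gh//; apply: AB; split=> //; exact: nbhs_singleton Bz.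
by apply: derivable_fst_slice; exact: ((sg 1%N).2 (1, 0)).1.
Qed.

Lemma smooth01_slice h t : smooth01 h -> t \in `[0, 1] -> smooth_on D (h t).
Proof.
move=> sh t01 k; apply: Ck_local => y Dy.
have [W [g [oW Wty sg gh]]] := sh t y t01 Dy.
exists ([set z | W (t, z)] `&` D); split=> //.
have oWD : open ([set z | W (t, z)] `&` D) by apply: openI => //; exact: open_slice.
apply: (@Ck_eq _ _ _ _ (fun z => g (t, z))) => //; first by move=> z [Wz Dz]; exact: gh.
by apply: Ck_sub (Ck_slice t (sg k)) => z [].
Qed.

Lemma smooth01_derive h v : smooth01 h -> smooth01 (fun t => 'D_v (h t)).
Proof.
move=> sh t y t01 Dy; have [W [g [oW Wty sg gh]]] := sh t y t01 Dy.
exists W, ('D_(0, v) g); split=> //; first by move=> k; exact: ((sg k.+1).2 (0, v)).2.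
move=> s z Wsz s01 Dz; rewrite -derive_slice; apply: near_eq_derive.
have : \forall z' \near z, ([set z' | W (s, z')] `&` D) z'.
  by apply: open_nbhs_nbhs; split=> //; apply: openI => //; exact: open_slice.
by apply: filterS => z' [Wz' Dz']; rewrite gh.
Qed.

Lemma smooth01_near h t y e : smooth01 h -> t \in `[0, 1] -> D y -> 0 < e ->
  \forall s \near t & z \near y, s \in `[0, 1] -> D z -> `|h s z - h t y| < e.
Proof.
move=> sh t01 Dy e0; have [W [g [oW Wty sg gh]]] := sh t y t01 Dy.
have cg : {for (t, y), continuous g} by exact: (sg 0%N).1.
have nW : \forall p \near (t, y), W p by apply: open_nbhs_nbhs; split.
have nE : \forall p \near (t, y), `|g (t, y) - g p| < e.
  by move/cvgrPdist_lt : cg => /(_ e e0).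
apply: filterS2 nW nE => -[s z] /= Wsz gsz s01 Dz.
by rewrite -!gh// distrC.
Qed.

Lemma smooth01_cont h y : smooth01 h -> D y -> cont01 (h ^~ y).
Proof.
move=> sh Dy; apply/subspace_continuousP => t t01.
apply/cvgrPdist_lt => e e0; rewrite near_withinE.
have [[A B] /= [At By] AB] := smooth01_near sh t01 Dy e0.
apply: filterS At => s As s01; rewrite distrC.
by apply: (AB (s, y)) => //; split=> //; exact: nbhs_singleton By.
Qed.

(** Joint continuity becomes uniform in time because the interval is compact. *)
Lemma smooth01_unif h y e : smooth01 h -> D y -> 0 < e ->
  \forall z \near y, forall s, s \in `[0, 1] -> `|h s z - h s y| < e.
Proof.
move=> sh Dy e0.
have e20 : 0 < e / 2 by rewrite divr_gt0.
have cpt : compact (`[0, 1] : set R) by exact: segment_compact.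
have nD : \forall z \near y, D z by apply: open_nbhs_nbhs; split.
have := compact_near_coveringP (`[0, 1] : set R).
case=> /(_ cpt) /(_ _ (nbhs y)
  (fun z s => s \in `[0, 1] -> D z -> `|h s z - h s y| < e)) + _.
move=> H; have {}H := H _.
have : \forall z \near y, `[0, 1] `<=` (fun s => s \in `[0, 1] -> D z -> `|h s z - h s y| < e).
  apply: H => t t01.
  have [[A B] /= [At By] AB] := smooth01_near sh t01 Dy e20.
  exists (A, B) => //= -[s z] /= [As Bz] s01 Dz.
  have h1 := AB (s, z) (conj As Bz) s01 Dz.
  have h2 := AB (s, y) (conj As (nbhs_singleton By)) s01 Dy.
  have := ler_distD (h t y) (h s z) (h s y); rewrite /= in h1 h2.
  rewrite (distrC (h t y)); lra.
by apply: filterS2 nD => z Dz + s s01; exact.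
Qed.

(** Reduces derivatives along [v] to derivatives in one real variable. *)
Lemma line_quotient (f : V -> R) (u : R) y v :
  (fun x : R => x^-1 *: (((fun u : R => f (u *: v + y)) \o shift u) (x *: 1)
      - f (u *: v + y))) =
  (fun x : R => x^-1 *: ((f \o shift (u *: v + y)) (x *: v) - f (u *: v + y))).
Proof.
apply/funext => x /=; congr (_ *: (f _ - _)).
by rewrite addrA -scalerDl /GRing.scale /= mulr1.
Qed.

(** Differentiation under the integral sign along the line through [y] in the
direction [v]. *)
Lemma smooth01_is_derive_integral h t y v : smooth01 h -> t \in `[0, 1] -> D y ->
  is_derive y v (fun z => integral01 (h ^~ z) t)
    (integral01 (fun s => 'D_v (h s) y) t).
Proof.
move=> sh t01 Dy; have sk := smooth01_derive v sh.
have [t0 t1] : 0 <= t /\ t <= 1 by move: t01; rewrite in_itv /= => /andP.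
pose P z := D z /\ forall s, s \in `[0, 1] -> `|'D_v (h s) z - 'D_v (h s) y| < 1.
have nP : \forall z \near y, P z.
  have nD : \forall z \near y, D z by apply: open_nbhs_nbhs; split.
  by apply: filterS2 nD (smooth01_unif sk Dy ltr01) => z; split.
have cl : (u *: v + y) @[u --> (0 : R)] --> y.
  rewrite -[X in _ --> X](_ : 0 *: v + y = y); last by rewrite scale0r add0r.
  by apply: cvgD; [apply: cvgZl; exact: cvg_id|exact: cvg_cst].
have [e /= e0 eP] : \forall u \near (0 : R), P (u *: v + y) by exact: cl nP.
have IP u : `]- e, e[%classic u -> P (u *: v + y).
  rewrite /= in_itv /= => ue; apply: eP => /=.
  by rewrite sub0r normrN ltr_norml.
have I0 : `]- e, e[%classic (0 : R) by rewrite /= in_itv /= e0 oppr_lt0 e0.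
have s01 s : `[0, t]%classic s -> s \in `[0, 1].
  by rewrite /= !in_itv /= => /andP[-> st]; exact: le_trans t1.
have mI : measurable (`[0, t] : set (measurableTypeR R)) by exact: measurable_itv.
pose f (u s : R) := h s (u *: v + y).
(* A dominating function: by uniformity in time, the derivative of [h s] along
   [v] stays within 1 of its value at [y] on the whole segment. *)
pose G (s : R) := `|'D_v (h s) y| + 1.
have dl s u : `[0, t]%classic s -> `]- e, e[%classic u ->
    is_derive u 1 (f ^~ s) ('D_v (h s) (u *: v + y)).
  move=> /s01 s01' /IP[Du _].
  have dh : derivable (h s) (u *: v + y) v by exact: ((smooth01_slice sh s01' 1%N).2 v).1.
  by split; rewrite /f /derivable /derive line_quotient.
have intf u : `]- e, e[%classic u -> lebesgue_measure.-integrable `[0, t] (EFin \o f u).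
  by move=> /IP[Du _]; apply: (cont01_integrable t01); exact: smooth01_cont.
have intG : lebesgue_measure.-integrable `[0, t] (EFin \o G).
  apply: (cont01_integrable t01) => s.
  by apply: cvgD; [apply: cvg_norm; exact: (smooth01_cont sk Dy)|exact: cvg_cst].
have G0 s : 0 <= G s by rewrite addr_ge0.
have d1E u s : `]- e, e[%classic u -> `[0, t]%classic s ->
    partial1of2 f u s = 'D_v (h s) (u *: v + y).
  by move=> Iu Is; rewrite partial1of2E; case: (dl s u Is Iu).
have Gub u s : `]- e, e[%classic u -> `[0, t]%classic s -> `|partial1of2 f u s| <= G s.
  move=> Iu Is; rewrite d1E// /G; have [_ /(_ s (s01 s Is)) lt1] := IP u Iu.
  rewrite -(subrK ('D_v (h s) y) ('D_v (h s) (u *: v + y))).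
  by apply: le_trans (ler_normD _ _) _; rewrite addrC lerD2l ltW.
have df u s : `]- e, e[%classic u -> `[0, t]%classic s -> derivable (f ^~ s) u 1.
  by move=> Iu Is; case: (dl s u Is Iu).
have := cvg_differentiation_under_integral mI I0 intf df G0 intG Gub.
have -> : \int[lebesgue_measure]_(s in `[0, t]) partial1of2 f 0 s =
    integral01 (fun s => 'D_v (h s) y) t.
  apply: eq_Rintegral => s /set_mem Is.
  by rewrite d1E// scale0r add0r.
set q := (X in X @ _ --> _ -> _) => cq.
have qE : q = (fun x : R => x^-1 *: (((fun z => integral01 (h ^~ z) t) \o shift y) (x *: v)
    - integral01 (h ^~ y) t)).
  by apply/funext => x; rewrite /q /f /= addr0 scale0r add0r.
rewrite qE in cq; split; first exact: cvgP cq.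
exact: cvg_lim cq.
Qed.

Lemma smooth01_integral h t : smooth01 h -> t \in `[0, 1] ->
  smooth_on D (fun y => integral01 (h ^~ y) t).
Proof.
move=> + t01 k; elim: k h => [|k IH] h sh.
all: have ch x : D x -> {for x, continuous (fun y => integral01 (h ^~ y) t)}.
1,3: move=> Dx; apply/cvgrPdist_le => e e0;
  have nD : \forall z \near x, D z by apply: open_nbhs_nbhs; split.
1,2: apply: filterS2 nD (smooth01_unif sh Dx e0) => z Dz hz.
1,2: apply: dist_integral01 => //; try exact: smooth01_cont.
1,2: by move=> s s01; rewrite distrC ltW// hz.
  by split.
split=> // v; split=> [x Dx|].
  by have := smooth01_is_derive_integral v sh t01 Dx => -[].
apply: (@Ck_eq _ _ _ _ (fun y => integral01 (fun s => 'D_v (h s) y) t)) => //.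
  move=> x Dx; have := smooth01_is_derive_integral v sh t01 Dx => -[_ ->] //.
exact: IH (smooth01_derive v sh).
Qed.

End SmoothFamilies.

(** * Linear functionals preserve linear relations *)

(** A relation between fixed vectors whose coefficients are functions on [X]
survives the application of a functional [T] to the coefficients.  By induction
on the number of vectors: if the first coefficient is zero on [X], its vector
can be dropped; if it is nonzero at some [t0], the relation at [t0] expresses
its vector in terms of the others, and substituting gives a shorter relation
whose coefficients are linear combinations of the old ones.  Relations hold
modulo a submodule [N], so that they can be read in a quotient which carries no
module structure; [C] is the domain on which [T] is linear. *)
Lemma linear_relation_functional (R : realType) (A : pzRingType)
    (iota : {rmorphism R -> A}) (V : lmodType A) (N : V -> Prop)
    (X : set R) (C : (R -> R) -> Prop) (T : (R -> R) -> R) (I : Type) (r : seq I)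
    (f : I -> R -> R) (v : I -> V) :
    (forall u w, N u -> N w -> N (u + w)) -> N 0 ->
    (forall a u, N u -> N (iota a *: u)) ->
    (forall g h a, C g -> C h -> C (fun t => g t + a * h t) /\
       T (fun t => g t + a * h t) = T g + a * T h) ->
    (forall g, (forall t, X t -> g t = 0) -> T g = 0) ->
    (forall i, C (f i)) ->
    (forall t, X t -> N (\sum_(i <- r) iota (f i t) *: v i)) ->
  N (\sum_(i <- r) iota (T (f i)) *: v i).
Proof.
move=> ND N0 NZ CT T0; elim: r f => [|j r IH] f Cf Nf; first by rewrite big_nil.
have [fj0|] := pselect (forall t, X t -> f j t = 0).
  rewrite big_cons T0// rmorph0 scale0r add0r; apply: IH => // t Xt.
  by have := Nf t Xt; rewrite big_cons fj0// rmorph0 scale0r add0r.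
move=> /existsNP[t0 /not_implyP[Xt0 /eqP fjt0]].
pose b i := - (f i t0 / f j t0).
(* The elimination holds for every functional [ev] that is linear on the
   coefficients: it is used for evaluation at a point of [X] and for [T]. *)
have elim_v (ev : (R -> R) -> R) :
    (forall i, ev (fun t => f i t + b i * f j t) = ev (f i) + b i * ev (f j)) ->
    \sum_(i <- r) iota (ev (fun t => f i t + b i * f j t)) *: v i =
    \sum_(i <- j :: r) iota (ev (f i)) *: v i -
    iota (ev (f j) / f j t0) *: \sum_(i <- j :: r) iota (f i t0) *: v i.
  move=> evE; rewrite !big_cons scalerDr scalerA -rmorphM divfK// scaler_sumr.
  rewrite opprD addrACA subrr add0r -sumrB; apply: eq_bigr => i _.
  rewrite evE rmorphD scalerDl; congr (_ + _).
  rewrite scalerA -rmorphM -scaleNr -rmorphN; congr (iota _ *: _).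
  by rewrite /b; field.
have Nr : N (\sum_(i <- r) iota (T (fun t => f i t + b i * f j t)) *: v i).
  apply: IH => [i|t Xt]; first by have [] := CT _ _ (b i) (Cf i) (Cf j).
  rewrite (elim_v (fun g => g t))//; apply: ND; first exact: Nf.
  by rewrite -scaleNr -rmorphN; apply: NZ; exact: Nf.
have := ND _ _ Nr (NZ (T (f j) / f j t0) _ (Nf t0 Xt0)).
by rewrite elim_v ?subrK// => i; have [] := CT _ _ (b i) (Cf i) (Cf j).
Qed.

(** * Fibers of a sheaf of modules *)

Section ConstantFunctions.
Variables (R : realType) (n : nat) (M : manifold R n) (U : opens M).

Lemma cst_smooth (a : R) : cst a \in @smooth_pred R n M U.
Proof.
apply/asboolP => ch _ k.
apply: (Ck_eq (@chart_img_open _ _ _ ch U) _ (Ck_cst k _ a)) => y [_ Uy] /=.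
by rewrite (ext0E (x := chart_inv ch y) _ Uy).
Qed.

Definition Cinf_cst (a : R) : Cinf U := MkCinf (cst_smooth a).

Lemma Cinf_cst_is_zmod_morphism : zmod_morphism Cinf_cst.
Proof. by move=> a b; apply: val_inj. Qed.

Lemma Cinf_cst_is_monoid_morphism : monoid_morphism Cinf_cst.
Proof. by split; [|move=> a b]; apply: val_inj. Qed.

HB.instance Definition _ :=
  GRing.isZmodMorphism.Build R (Cinf U) Cinf_cst Cinf_cst_is_zmod_morphism.
HB.instance Definition _ :=
  GRing.isMonoidMorphism.Build R (Cinf U) Cinf_cst Cinf_cst_is_monoid_morphism.

End ConstantFunctions.

Section Fibers.
Variables (R : realType) (n : nat) (M : manifold R n) (E : module_sheaf M).
Variables (U : opens M) (x : M) (Ux : opens_set U x).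
Implicit Types (e : sec E U) (f : Cinf U).
Local Open Scope quotient_scope.

Let gm (e : sec E U) : stalk (presheaf_of E) x := germ (P := presheaf_of E) Ux e.

Lemma Fib0P e : Fib Ux e = 0 <-> max_ideal_mul (gm e).
Proof.
rewrite -[X in _ <-> is_true (_ X)]subr0 -[max_ideal_mul _]/(gm e - 0 \in @max_ideal_mul _ _ _ E x).
rewrite Quotient.idealrBE; split=> [h|/eqP h].
  apply/eqP; rewrite -[LHS]/(Fib Ux e) h; exact/esym/raddf0.
by rewrite /Fib -/(gm e) h; exact: raddf0.
Qed.

Lemma FibB e e' : Fib Ux (e - e') = Fib Ux e - Fib Ux e'.
Proof.
rewrite /Fib -raddfB; congr (\pi _).
by rewrite -[RHS]/(stalk_add _ (stalk_opp _)) germN germD.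
Qed.

Lemma Fib0 : Fib Ux (0 : sec E U) = 0.
Proof. by have := FibB 0 0; rewrite !subrr. Qed.

Lemma FibD e e' : Fib Ux (e + e') = Fib Ux e + Fib Ux e'.
Proof. by rewrite -[e' in LHS]opprK FibB -[- e']add0r FibB Fib0 sub0r opprK. Qed.

Lemma Fib_sum (I : Type) (s : seq I) (F : I -> sec E U) :
  Fib Ux (\sum_(i <- s) F i) = \sum_(i <- s) Fib Ux (F i).
Proof. by elim/big_rec2: _ => [|i a b _ <-]; [exact: Fib0|exact: FibD]. Qed.

Lemma Fib_scale_vanish f e : f (exist _ x (mem_set Ux)) = 0 -> Fib Ux (f *: e) = 0.
Proof.
move=> fx; apply/Fib0P/asboolP.
exists 1%N, (fun=> germ (P := Cinf_presheaf M) Ux f), (fun=> gm e).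
by rewrite big_ord1 germ_scaleE; split=> // i; rewrite /max_ideal /= germ_evalE.
Qed.

(** The fiber only sees the value of a coefficient at [x]. *)
Lemma Fib_scale f e :
  Fib Ux (f *: e) = Fib Ux (Cinf_cst U (f (exist _ x (mem_set Ux))) *: e).
Proof.
apply/eqP; rewrite -subr_eq0 -FibB -scalerBl; apply/eqP/Fib_scale_vanish.
exact: subrr.
Qed.

Lemma germ_scaleDr (f : stalk (Cinf_presheaf M) x) (u v : stalk (presheaf_of E) x) :
  germ_scale f (u + v) = germ_scale f u + germ_scale f v.
Proof.
have [V [Vx [g ->]]] := germ_surj f; have [W [Wx [s [t [-> ->]]]]] := germ_surj2 u v.
have VWx : opens_set (opensI V W) x by [].
rewrite -(germ_res Vx VWx (@opensIl _ V W) g).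
rewrite -(germ_res Wx VWx (@opensIr _ V W) s) -(germ_res Wx VWx (@opensIr _ V W) t).
rewrite -[germ _ _ + germ _ _]/(stalk_add _ _) germD !germ_scaleE.
by rewrite -[RHS]/(stalk_add _ _) germD; congr germ; exact: scalerDr.
Qed.

Lemma germ_scaleC (f g : stalk (Cinf_presheaf M) x) (u : stalk (presheaf_of E) x) :
  germ_scale f (germ_scale g u) = germ_scale g (germ_scale f u).
Proof.
have [V [Vx [a [b [-> ->]]]]] := germ_surj2 f g; have [W [Wx [s ->]]] := germ_surj u.
have VWx : opens_set (opensI V W) x by [].
rewrite -(germ_res Vx VWx (@opensIl _ V W) a) -(germ_res Vx VWx (@opensIl _ V W) b).
rewrite -(germ_res Wx VWx (@opensIr _ V W) s) !germ_scaleE.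
by congr germ; rewrite !scalerA mulrC.
Qed.

(** The sections that vanish in the fiber form a submodule, since the maximal
ideal times the stalk is one. *)
Lemma Fib0_scale f e : Fib Ux e = 0 -> Fib Ux (f *: e) = 0.
Proof.
move=> /Fib0P/asboolP[k [g [v [mg ge]]]]; apply/Fib0P/asboolP.
pose gf := germ (P := Cinf_presheaf M) Ux f.
exists k, g, (fun i => germ_scale gf (v i)); split=> //.
rewrite /gm -germ_scaleE -/(gm e) ge.
elim: k g v {mg ge} => [|k IH] g v.
  rewrite !big_ord0; have := germ_scaleDr gf 0 (- 0).
  by rewrite germ_scaleN !subrr.
by rewrite !big_ord_recr /= germ_scaleDr IH germ_scaleC.
Qed.

Lemma Fib_local (V : opens M) (VU : V `<=` U) e e' : opens_set V x ->
  res E VU e = res E VU e' -> Fib Ux e = Fib Ux e'.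
Proof.
move=> Vx h; rewrite /Fib; congr (\pi _); apply/germP; exists V, VU, VU; split=> //.
Qed.

End Fibers.

(** * Locally finite sums *)

Section LocallyFiniteSums.
Variables (R : realType) (n : nat) (M : manifold R n) (E : module_sheaf M).
Variables (U : opens M) (I : choiceType).
Implicit Types (F : I -> Cinf U) (e : I -> sec E U) (J : {fset I}).

Lemma locfin_big F e (V : opens M) (VU : V `<=` U) J :
    (forall i, i \notin J -> Cinf_res VU (F i) = 0) ->
  \sum_(i \in [set: I]) (Cinf_res VU (F i) *: res E VU (e i)) =
  res E VU (\sum_(i <- J) F i *: e i).
Proof.
move=> FJ; rewrite (fsbigTE J) => [|i /FJ ->]; last by rewrite scale0r.
by rewrite raddf_sum; apply: eq_bigr => i _; rewrite resZ.
Qed.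

(** Gluing over the cover by all open sets on which the family is finite; using
all of them gives the defining property of the sum at once. *)
Lemma locfin_exists F e :
    (forall x, opens_set U x -> exists (V : opens M) (VU : V `<=` U),
      opens_set V x /\ finite_set [set i | Cinf_res VU (F i) != 0]) ->
  exists s : sec E U, forall (V : opens M) (VU : V `<=` U),
    finite_set [set i | Cinf_res VU (F i) != 0] ->
    res E VU s = \sum_(i \in [set: I]) (Cinf_res VU (F i) *: res E VU (e i)).
Proof.
move=> lF.
pose K := {V : opens M | exists VU : V `<=` U,
  finite_set [set i | Cinf_res VU (F i) != 0]}.
have VU (j : K) : sval j `<=` U by case: (svalP j).
have fin (j : K) : finite_set [set i | Cinf_res (VU j) (F i) != 0].
  by case: (svalP j) => h; rewrite (Prop_irrelevance h (VU j)).
pose J (j : K) := fset_set [set i | Cinf_res (VU j) (F i) != 0].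
have FJ j i : i \notin J j -> Cinf_res (VU j) (F i) = 0.
  by rewrite in_fset_set// notin_setE /= => /negP/negPn/eqP.
pose S (j : K) := \sum_(i \in [set: I]) (Cinf_res (VU j) (F i) *: res E (VU j) (e i)).
have SE j : S j = res E (VU j) (\sum_(i <- J j) F i *: e i) by apply: locfin_big; exact: FJ.
have Sres (j : K) (W : opens M) (WV : W `<=` sval j) (WU : W `<=` U) : res E WV (S j) =
    \sum_(i \in [set: I]) (Cinf_res WU (F i) *: res E WU (e i)).
  have FW i : i \notin J j -> Cinf_res WU (F i) = 0.
    by move=> /FJ Fi0; rewrite -(Cinf_res_comp (VU j) WV) Fi0 raddf0.
  by rewrite SE (res_comp (VU j) WV WU) (locfin_big e FW).
have cov : U `<=` \bigcup_(j : K) sval j.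
  by move=> x /lF[V [h [Vx f]]]; exists (exist _ V (ex_intro _ h f)).
have compat (i j : K) : res E (@opensIl _ (sval i) (sval j)) (S i) =
    res E (@opensIr _ (sval i) (sval j)) (S j).
  have WU : opensI (sval i) (sval j) `<=` U by move=> y [/VU].
  by rewrite (Sres i _ _ WU) (Sres j _ _ WU).
have [s sS] := sheaf_gluing (V := fun j : K => sval j) VU cov compat.
exists s => V h f; pose j : K := exist _ V (ex_intro _ h f).
by have := sS j; rewrite /S (Prop_irrelevance (VU j) h).
Qed.

(** Near [x] the sum is finite, and replacing each coefficient by its value at
[x] does not change the fiber. *)
Lemma Fib_locfin_sum (f : I -> U -> R) e s (V : opens M) (VU : V `<=` U) J
    (x : M) (Ux : opens_set U x) :
    locfin_sum f e s -> opens_set V x ->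
    (forall i, i \notin J -> forall q : U, opens_set V (val q) -> f i q = 0) ->
  Fib Ux s =
  Fib Ux (\sum_(i <- J) Cinf_cst U (f i (exist _ x (mem_set Ux))) *: e i).
Proof.
move=> [F [Ff _ sF]] Vx fJ.
have F0 i : i \notin J -> Cinf_res VU (F i) = 0.
  move=> iJ; apply: val_inj; apply/funext => q /=; rewrite /restr Ff.
  by apply: fJ => //=; exact: set_mem (valP q).
have finF : finite_set [set i | Cinf_res VU (F i) != 0].
  apply: (@sub_finite_set _ _ [set` J]); last exact: finite_fset.
  by move=> i /= Fi; apply: contraNT Fi => /F0 ->.
rewrite (Fib_local Ux Vx (etrans (sF V VU finF) (locfin_big _ F0))).
by rewrite !Fib_sum; apply: eq_bigr => i _; rewrite Fib_scale Ff.
Qed.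

End LocallyFiniteSums.

Section FsetFilter.
Variable I : choiceType.

(** With this filter the finite set of indices can vary together with the
neighborhood in a compactness argument. *)
Definition large_fsets : set_system {fset I} :=
  [set S | exists J0 : {fset I}, forall J : {fset I}, (J0 `<=` J)%fset -> S J].

Lemma large_fsets_filter : Filter large_fsets.
Proof.
split; first by exists fset0.
  move=> P Q [J0 PJ] [J1 QJ]; exists (J0 `|` J1)%fset => J.
  by rewrite fsubUset => /andP[/PJ ? /QJ].
by move=> P Q PQ [J0 PJ]; exists J0 => J /PJ /PQ.
Qed.

End FsetFilter.

Section Parameterizations.
Variables (R : realType) (n : nat) (M : manifold R n) (E : module_sheaf M).
Variable U : opens M.

(** The tube lemma: local finiteness on [[0, 1] x U] gives, around each point of
[U], a neighborhood and a finite set of indices valid for all times. *)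
Lemma parameterization_tube (alpha : R -> sec E U) (I : choiceType) (c : I -> R -> U -> R)
    (e : I -> sec E U) (x : M) :
    parameterization alpha c e -> opens_set U x ->
  exists (V : opens M) (VU : V `<=` U) (J : {fset I}), opens_set V x /\
    forall i, i \notin J -> forall s, s \in `[0, 1] ->
    forall q : U, opens_set V (val q) -> c i s q = 0.
Proof.
move=> [_ lc _] Ux; have fF := large_fsets_filter I.
pose P (z : M * {fset I}) (s : R) := s \in `[0, 1] ->
  forall i, i \notin z.2 -> forall q : U, val q = z.1 -> c i s q = 0.
have cpt : compact (`[0, 1] : set R) by exact: segment_compact.
have [nc _] := compact_near_coveringP (`[0, 1] : set R).
have [|[B S] /= [Bx [J SJ]] BSP] :=
  nc cpt _ (filter_prod (nbhs x) (@large_fsets I)) P _.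
  move=> t t01; have [A [B [At Bx]]] := lc t x t01 Ux.
  set Z := [set i | _] => fin; pose L := [set J : {fset I} | Z `<=` [set` J]].
  exists (A, B `*` L) => /=.
    split=> //; exists (B, L) => //=; split=> //; exists (fset_set Z).
    by move=> J /fsubsetP ZJ i Zi; apply: ZJ; rewrite in_fset_set//; exact: mem_set.
  move=> [s [y J]] /= [As [By sJ]] s01 i /= iJ q qy.
  apply/eqP; apply: contraNT iJ => ci; apply: sJ; exists s, q; split=> //.
  by move: By; rewrite -[X in B X -> _]qy.
have oV : open (B° `&` U) by apply: openI; [exact: open_interior|exact: opens_open].
exists (Opens oV), (@subIsetr _ _ _), J; split=> //.
move=> i iJ s s01 q /= [Bq _].
apply: (BSP (val q, J)) => //=; split; first exact: interior_subset.
exact/SJ/fsubset_refl.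
Qed.

End Parameterizations.

(** * Applying a functional to a parameterization *)

Section PathFunctionals.
Variables (R : realType) (n : nat) (M : manifold R n) (U : opens M).

(** What differentiation at a time and integration up to a time have in common;
[C] is a space of functions on which [T] is linear. *)
Record path_functional (C : (R -> R) -> Prop) (T : (R -> R) -> R) : Prop := PathFunctional {
  pf_linear : forall f g a, C f -> C g -> C (fun t => f t + a * g t) /\
    T (fun t => f t + a * g t) = T f + a * T g;
  pf_local : forall f, (forall t, t \in `[0, 1] -> f t = 0) -> T f = 0;
  pf_dom : forall (c : R -> U -> R) q, smooth_fun01 c -> C (c ^~ q);
  pf_smooth : forall c : R -> U -> R, smooth_fun01 c -> smooth_fun (fun q => T (c ^~ q)) }.

Variables (E : module_sheaf M) (C : (R -> R) -> Prop) (T : (R -> R) -> R).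
Hypothesis CT : path_functional C T.

Lemma path_functional_sum (alpha : R -> sec E U) (I : choiceType) (c : I -> R -> U -> R)
    (e : I -> sec E U) : parameterization alpha c e ->
  exists s, locfin_sum (fun i q => T (c i ^~ q)) e s.
Proof.
move=> pc; have [sc _ _] := pc.
have sT i : (fun q => T (c i ^~ q)) \in @smooth_pred R n M U by apply/asboolP/(pf_smooth CT).
pose F i : Cinf U := MkCinf (sT i).
have lF x : opens_set U x -> exists (V : opens M) (VU : V `<=` U),
    opens_set V x /\ finite_set [set i | Cinf_res VU (F i) != 0].
  move=> Ux; have [V [VU [J [Vx cJ]]]] := parameterization_tube pc Ux.
  exists V, VU; split=> //; apply: (@sub_finite_set _ _ [set` J]); last exact: finite_fset.
  move=> i /=; apply: contraNT => iJ; apply/eqP/val_inj/funext => q /=.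
  rewrite /restr /=; apply: (pf_local CT) => t t01.
  by apply: cJ => //=; exact: set_mem (valP q).
have [s sF] := locfin_exists e lF.
by exists s, F.
Qed.

Hypothesis HE : fiber_determined E.

(** The difference of the two sums is, in each fiber, the image under [T] of the
relation that says that both parameterizations have the same sum. *)
Lemma path_functional_unique (alpha : R -> sec E U)
    (I : choiceType) (c : I -> R -> U -> R) (e : I -> sec E U)
    (I' : choiceType) (c' : I' -> R -> U -> R) (e' : I' -> sec E U) s s' :
  parameterization alpha c e -> parameterization alpha c' e' ->
  locfin_sum (fun i q => T (c i ^~ q)) e s ->
  locfin_sum (fun i q => T (c' i ^~ q)) e' s' -> s = s'.
Proof.
move=> pc pc' sT sT'; apply/eqP; rewrite -subr_eq0; apply/eqP/HE => x Ux.
have [V [VU [J [Vx cJ]]]] := parameterization_tube pc Ux.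
have [V' [VU' [J' [Vx' cJ']]]] := parameterization_tube pc' Ux.
pose p : U := exist _ x (mem_set Ux).
(* The two parameterizations are merged into a single relation, with the
   vectors of the second one negated. *)
pose r : seq (I + I') := map inl J ++ map inr J'.
pose f (i : I + I') := match i with inl i => c i ^~ p | inr i => c' i ^~ p end.
pose w (i : I + I') := match i with inl i => e i | inr i => - e' i end.
have sumr (ev : (R -> R) -> R) : \sum_(i <- r) Cinf_cst U (ev (f i)) *: w i =
    \sum_(i <- J) Cinf_cst U (ev (c i ^~ p)) *: e i -
    \sum_(i <- J') Cinf_cst U (ev (c' i ^~ p)) *: e' i.
  rewrite big_cat !big_map /= -sumrN; congr (_ + _).
  by apply: eq_bigr => i _; rewrite scalerN.
rewrite FibB (Fib_locfin_sum VU Ux sT Vx (J := J)); last first.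
  by move=> i iJ q Vq; apply: (pf_local CT) => t t01; exact: cJ.
rewrite (Fib_locfin_sum VU' Ux sT' Vx' (J := J')); last first.
  by move=> i iJ q Vq; apply: (pf_local CT) => t t01; exact: cJ'.
rewrite -FibB -sumr.
apply: (@linear_relation_functional R (Cinf U) (@Cinf_cst R n M U) (sec E U)
  (fun u => Fib Ux u = 0) [set` `[0, 1]] C T).
- by move=> u v u0 v0; rewrite FibD u0 v0 addr0.
- exact: Fib0.
- by move=> a v; exact: Fib0_scale.
- exact: pf_linear CT.
- exact: pf_local CT.
- have [sc _ _] := pc; have [sc' _ _] := pc'.
  by case=> i; exact: (pf_dom CT).
- move=> t t01; rewrite (sumr (fun f => f t)) FibB.
  have [_ _ /(_ t t01) lt] := pc; have [_ _ /(_ t t01) lt'] := pc'.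
  rewrite -(Fib_locfin_sum VU Ux lt Vx (J := J)); last by move=> i iJ q Vq; exact: cJ.
  rewrite -(Fib_locfin_sum VU' Ux lt' Vx' (J := J')); last by move=> i iJ q Vq; exact: cJ'.
  by rewrite subrr.
Qed.

End PathFunctionals.

(** * Derivatives and integrals of smooth paths *)

Section DerivativeIntegral.
Variables (R : realType) (n : nat) (M : manifold R n) (U : opens M).
Implicit Types (c : R -> U -> R) (t : R).

Lemma ext0_val (T : Type) (A : set T) (f : A -> R) (q : A) : ext0 f (val q) = f q.
Proof. by rewrite /ext0 valK. Qed.

(** A chart around [q] turns pointwise statements on [U] into statements on an
open subset of R^n. *)
Lemma smooth_fun01_at c (q : U) : smooth_fun01 c ->
  exists (D : set 'rV[R]_n) h y, [/\ open D, D y, smooth01 D h & (fun s => h s y) = c ^~ q].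
Proof.
move=> sc; have Uq : opens_set U (val q) by exact: set_mem (valP q).
have [a Aa aq] := mfd_cover (val q).
exists (chart_img a U), (fun s => ext0 (c s) \o chart_inv a), (chart_map a (val q)).
split.
- exact: chart_img_open.
- split; first exact: chart_map_cod.
  by rewrite /= chart_mapK.
- exact: sc.
- by apply/funext => s; rewrite /= chart_mapK// ext0_val.
Qed.

Lemma smooth_fun_chart (f : U -> R) (g : chart R n M -> 'rV[R]_n -> R) :
    (forall a, @mfd_atlas R n M a -> smooth_on (chart_img a U) (g a)) ->
    (forall a y, chart_img a U y -> g a y = ext0 f (chart_inv a y)) ->
  smooth_fun f.
Proof.
move=> sg gf a Aa k.
by apply: (Ck_eq (@chart_img_open _ _ _ a U) _ (sg a Aa k)) => y /gf.
Qed.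

Lemma smooth_fun01_ddt c : smooth_fun01 c -> smooth_fun01 (ddt c).
Proof.
move=> sc a Aa t y t01 Dy.
have [W [g [oW Wty sg gh]]] := smooth01_deriv01 (sc a Aa) t01 Dy.
exists W, g; split=> // s z Wsz s01 Dz; rewrite gh//.
have [_ Uz] := Dz; rewrite (ext0E (x := chart_inv a z) _ Uz) /ddt -/(deriv01 _ s); congr deriv01.
by apply/funext => u; rewrite /= (ext0E (x := chart_inv a z) _ Uz).
Qed.

Lemma path_functional_deriv01 t : t \in `[0, 1] ->
  path_functional U (fun f => exists psi, derivable_ext_at f t psi) (fun f => deriv01 f t).
Proof.
move=> t01; split.
- move=> f g a [psi [fp dp]] [chi [gc dc]].
  have e : derivable_ext_at (fun s => f s + a * g s) t (psi + a *: chi).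
    split; last by apply: derivableD => //; exact: derivableZ.
    by apply: filterS2 fp gc => s fs gs s01; rewrite fs// gs.
  split; first by exists (psi + a *: chi).
  rewrite (deriv01E t01 e) (deriv01E t01 (conj fp dp)) (deriv01E t01 (conj gc dc)).
  by rewrite (deriveD dp (derivableZ dc)) (deriveZ _ dc).
- move=> f f0; rewrite (@deriv01E _ _ _ (cst 0)) ?derive_cst//.
  by split; [apply: filterE => s; exact: f0|exact: derivable_cst].
- move=> c q /smooth_fun01_at - /(_ q)[D [h [y [oD Dy sh <-]]]].
  exact: smooth01_derivable_ext sh t01 Dy.
- move=> c /smooth_fun01_ddt sc.
  apply: (@smooth_fun_chart _ (fun a => ext0 (ddt c t) \o chart_inv a)) => // a Aa.
  exact: (smooth01_slice (@chart_img_open _ _ _ a U)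
    (h := fun s => ext0 (ddt c s) \o chart_inv a) (sc a Aa) t01).
Qed.

Lemma path_functional_integral01 t : t \in `[0, 1] ->
  path_functional U (@cont01 R) (fun f => integral01 f t).
Proof.
move=> t01; have mI : measurable (`[0, t] : set (measurableTypeR R)) by exact: measurable_itv.
split.
- move=> f g a cf cg.
  have cag : cont01 (fun s => a * g s).
    by move=> s; apply: cvgM; [exact: cvg_cst|exact: cg].
  split; first by move=> s; apply: cvgD; [exact: cf|exact: cag].
  rewrite /integral01 (RintegralD mI (cont01_integrable t01 cf) (cont01_integrable t01 cag)).
  by rewrite (RintegralZl _ mI (cont01_integrable t01 cg)).
- move=> f f0; rewrite /integral01 (@eq_Rintegral _ _ _ _ _ (cst 0)).
    by rewrite (Rintegral_cst _ mI) mul0r.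
  move=> s /set_mem /=; rewrite !in_itv /= => /andP[s0 st]; apply: f0.
  move: t01; rewrite !in_itv /= s0 => /andP[_]; exact: le_trans.
- move=> c q /smooth_fun01_at - /(_ q)[D [h [y [oD Dy sh <-]]]].
  exact: smooth01_cont sh Dy.
- move=> c sc; apply: (@smooth_fun_chart _
    (fun a y => integral01 (fun s => ext0 (c s) (chart_inv a y)) t)) => a.
    move=> Aa.
    exact: (smooth01_integral (@chart_img_open _ _ _ a U) (sc a Aa) t01).
  move=> y [_ Uy]; rewrite (ext0E (x := chart_inv a y) _ Uy); congr integral01.
  by apply/funext => s; rewrite (ext0E (x := chart_inv a y) _ Uy).
Qed.

Lemma int0_ddt c t (q : U) : smooth_fun01 c -> t \in `[0, 1] ->
  int0 (ddt c) t q = c t q - c 0 q.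
Proof.
move=> /smooth_fun01_at - /(_ q)[D [h [y [oD Dy sh hc]]]] t01.
have := @ftc01 _ (c ^~ q) t t01; apply; rewrite -hc.
  by move=> s s01; exact: smooth01_derivable_ext sh s01 Dy.
exact: (smooth01_cont (smooth01_deriv01 sh) Dy).
Qed.

Variables (E : module_sheaf M) (alpha : R -> sec E U).

(** The value at [t] is chosen from one parameterization; by uniqueness it is
then the right one for all others. *)
Lemma path_functional_family (C : R -> (R -> R) -> Prop) (T : R -> (R -> R) -> R) :
    fiber_determined E -> smooth_path alpha ->
    (forall t, t \in `[0, 1] -> path_functional U (C t) (T t)) ->
  exists beta : R -> sec E U, forall (I : choiceType) (c : I -> R -> U -> R) (e : I -> sec E U),
    parameterization alpha c e ->
    forall t, t \in `[0, 1] -> locfin_sum (fun i q => T t (c i ^~ q)) e (beta t).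
Proof.
move=> HE [I0 [c0 [e0 p0]]] CT.
have /choice[beta betaP] : forall t, exists s : sec E U,
    t \in `[0, 1] -> locfin_sum (fun i q => T t (c0 i ^~ q)) e0 s.
  move=> t; have [t01|nt01] := boolP (t \in `[0, 1]); last by exists 0.
  by have [s sP] := path_functional_sum (CT t t01) p0; exists s.
exists beta => I c e pc t t01.
have [s sP] := path_functional_sum (CT t t01) pc.
by rewrite (path_functional_unique (CT t t01) HE p0 pc (betaP t t01) sP).
Qed.

(** The local extensions of [c i] can be differentiated, and where [c i] vanishes
for all times so does its derivative. *)
Lemma parameterization_ddt (beta : R -> sec E U) (I : choiceType) (c : I -> R -> U -> R)
    (e : I -> sec E U) :
    parameterization alpha c e ->
    (forall t, t \in `[0, 1] -> locfin_sum (fun i => ddt (c i) t) e (beta t)) ->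
  parameterization beta (fun i => ddt (c i)) e.
Proof.
move=> pc db; have [sc _ _] := pc; split=> //; first by move=> i; exact: smooth_fun01_ddt.
move=> t x t01 Ux; have [V [VU [J [Vx cJ]]]] := parameterization_tube pc Ux.
exists setT, V; split; first exact: filterT.
  by apply: open_nbhs_nbhs; split=> //; exact: opens_open.
apply: (@sub_finite_set _ _ [set` J]); last exact: finite_fset.
move=> i /= [s [q [s01 _ Vq]]]; apply: contraNT => iJ; apply/eqP.
by apply: (pf_local (path_functional_deriv01 s01)) => u u01; exact: cJ.
Qed.

End DerivativeIntegral.

Theorem lemma4p15 (R : realType) (n : nat) (M : manifold R n)
    (E : module_sheaf M) (HE : fiber_determined E) (U : opens M)
    (alpha : R -> sec E U) (Halpha : smooth_path alpha) :
  exists dalpha ialpha idalpha : R -> sec E U,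
    [/\ is_ddt alpha dalpha, is_int0 alpha ialpha,
        smooth_path dalpha, is_int0 dalpha idalpha &
        forall t : R, t \in `[0, 1] -> alpha t = alpha 0 + idalpha t].
Proof.
have [dalpha dP] := path_functional_family HE Halpha (@path_functional_deriv01 R n M U).
have [ialpha iP] := path_functional_family HE Halpha (@path_functional_integral01 R n M U).
have [I [c [e pc]]] := Halpha; have pd := parameterization_ddt pc (dP _ _ _ pc).
have sd : smooth_path dalpha by exists I, (fun i => ddt (c i)), e.
have [idalpha idP] := path_functional_family HE sd (@path_functional_integral01 R n M U).
exists dalpha, ialpha, idalpha; split=> // t t01.
have h0 : 0 \in `[0, 1 : R] by rewrite in_itv /= lexx ler01.
apply/eqP; rewrite -subr_eq0 opprD addrA; apply/eqP/HE => x Ux.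
(* One tube serves [alpha t], [alpha 0] and the integral, which reduces the
   claim to the same identity for each coefficient. *)
have [V [VU [J [Vx cJ]]]] := parameterization_tube pc Ux.
have [sc _ la] := pc; have li := idP _ _ _ pd t t01.
rewrite !FibB (Fib_locfin_sum VU Ux (la t t01) Vx (J := J)); last first.
  by move=> i iJ q Vq; exact: cJ.
rewrite (Fib_locfin_sum VU Ux (la 0 h0) Vx (J := J)); last first.
  by move=> i iJ q Vq; exact: cJ.
rewrite (Fib_locfin_sum VU Ux li Vx (J := J)); last first.
  move=> i iJ q Vq; rewrite -[LHS]/(int0 (ddt (c i)) t q) int0_ddt//.
  by rewrite !(cJ i iJ _ _ q Vq)// subrr.
rewrite -!FibB -!sumrB -[RHS](Fib0 E Ux); congr Fib; apply: big1 => i _.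
rewrite -[integral01 _ t]/(int0 (ddt (c i)) t _) int0_ddt//.
by rewrite rmorphB scalerBl subrr.
Qed.
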